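(* Let $A\in \mathbb{R}^{m\times n}$, $B\in \mathbb{R}^{m\times p}$, $C\in \mathbb{R}^{s\times n}$, $D\in \mathbb{R}^{s\times p}$, and let $F=D-CA^\dagger B$ and $G=A-BD^\dagger C$. Suppose that $F=0$. Then $G=0$ if and only if $(I-BB^\dagger)A=0$, $A(I-C^\dagger C)=0$ and $(CA^\dagger B)^\dagger =B^\dagger AC^\dagger$.
   Context: For a real matrix $X$, $X^\dagger$ denotes its Moore-Penrose inverse, i.e. the unique real matrix $Y$ with $XYX=X$, $YXY=Y$, $(XY)^T=XY$, $(YX)^T=YX$. $I$ denotes an identity matrix of the appropriate size. For the block matrix $M=\begin{pmatrix}A&B\\C&D\end{pmatrix}$, $F$ is called the pseudo Schur complement of $A$ in $M$ and $G$ the complementary pseudo Schur complement of $D$ in $M$. *)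

(* Defs.v *)
From HB Require Import structures.
From mathcomp Require Import all_boot all_order all_algebra.
Set Implicit Arguments.
Unset Strict Implicit.
Unset Printing Implicit Defensive.
Import Order.TTheory GRing.Theory Num.Theory.
Local Open Scope ring_scope.

Definition is_pinv (R : realFieldType) (m n : nat)
    (X : 'M[R]_(m, n)) (Y : 'M[R]_(n, m)) : bool :=
  [&& X *m Y *m X == X, Y *m X *m Y == Y,
      (X *m Y)^T == X *m Y & (Y *m X)^T == Y *m X].

Lemma is_pinvP (R : realFieldType) (m n : nat)
    (X : 'M[R]_(m, n)) (Y : 'M[R]_(n, m)) :
  reflect [/\ X *m Y *m X = X, Y *m X *m Y = Y,
              (X *m Y)^T = X *m Y & (Y *m X)^T = Y *m X] (is_pinv X Y).
Proof.
by apply: (iffP and4P) => -[/eqP ? /eqP ? /eqP ? /eqP ?]; split=> //; apply/eqP.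
Qed.

Lemma is_pinv_unique (R : realFieldType) (m n : nat)
    (X : 'M[R]_(m, n)) (Y Z : 'M[R]_(n, m)) :
  is_pinv X Y -> is_pinv X Z -> Y = Z.
Proof.
move=> /is_pinvP[Y1 Y2 Y3 Y4] /is_pinvP[Z1 Z2 Z3 Z4].
have XYZ : X *m Y = X *m Z.
  by rewrite -Y3 -{1}Z1 -(mulmxA (X *m Z)) trmx_mul Y3 Z3 mulmxA Y1.
have YXZ : Y *m X = Z *m X.
  by rewrite -Y4 -{1}Z1 -(mulmxA X) mulmxA trmx_mul Y4 Z4 -!mulmxA (mulmxA X) Y1.
by rewrite -Y2 -mulmxA XYZ mulmxA YXZ Z2.
Qed.

Lemma mulmx_trmx_eq0 (R : realFieldType) (n : nat) (u : 'rV[R]_n) :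
  u *m u^T = 0 -> u = 0.
Proof.
move=> /matrixP/(_ 0 0); rewrite !mxE => h; apply/matrixP=> i j.
rewrite ord1 mxE; apply/eqP; rewrite -sqrf_eq0 expr2.
have /psumr_eq0P-/(_ _ j isT) : forall k, true -> 0 <= u 0 k * u 0 k.
  by move=> k _; rewrite -expr2 sqr_ge0.
by move=> ->//; rewrite -[RHS]h; apply: eq_bigr => k _; rewrite mxE.
Qed.

Lemma row_free_gram_unit (R : realFieldType) (m n : nat) (X : 'M[R]_(m, n)) :
  row_free X -> X *m X^T \in unitmx.
Proof.
move=> fX; rewrite -row_free_unit -kermx_eq0; apply/eqP/row_matrixP => i.
rewrite row0; apply: (row_free_inj fX); rewrite mul0mx.
apply: mulmx_trmx_eq0; rewrite trmx_mul mulmxA -(mulmxA _ X).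
by rewrite -row_mul mulmx_ker row0 mul0mx.
Qed.

Lemma is_pinv_full_rank (R : realFieldType) (m n r : nat)
    (K : 'M[R]_(m, r)) (L : 'M[R]_(r, n)) :
  row_free K^T -> row_free L ->
  is_pinv (K *m L)
    (L^T *m invmx (L *m L^T) *m (invmx (K^T *m K) *m K^T)).
Proof.
move=> /row_free_gram_unit; rewrite trmxK => uK /row_free_gram_unit uL.
set P := invmx (L *m L^T); set Q := invmx (K^T *m K); set Y := _ *m (Q *m _).
have PT : P^T = P by rewrite /P trmx_inv trmx_mul trmxK.
have QT : Q^T = Q by rewrite /Q trmx_inv trmx_mul trmxK.
have XY : K *m L *m Y = K *m Q *m K^T.
  by rewrite /Y !mulmxA -(mulmxA K L) -(mulmxA K _ P) mulmxV // mulmx1.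
have YX : Y *m (K *m L) = L^T *m P *m L.
  by rewrite /Y !mulmxA -(mulmxA _ K^T K) -(mulmxA _ Q) mulVmx // mulmx1.
apply/is_pinvP; split.
- by rewrite XY !mulmxA -(mulmxA _ K^T K) -(mulmxA _ Q) mulVmx // mulmx1.
- by rewrite YX /Y !mulmxA -(mulmxA _ L) -(mulmxA _ _ P) mulmxV // mulmx1.
- by rewrite XY !trmx_mul trmxK QT mulmxA.
- by rewrite YX !trmx_mul trmxK PT mulmxA.
Qed.

Lemma pinv_exists (R : realFieldType) (m n : nat) (X : 'M[R]_(m, n)) :
  exists Y : 'M[R]_(n, m), is_pinv X Y.
Proof.
rewrite -(mulmx_base X); eexists; apply: is_pinv_full_rank.
  by rewrite /row_free mxrank_tr; exact: col_base_full.
exact: row_base_free.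
Qed.

(* The Moore-Penrose inverse: the chosen matrix is the only one satisfying
   [is_pinv X], by [is_pinv_unique]. *)
Definition pinv (R : realFieldType) (m n : nat) (X : 'M[R]_(m, n)) :
  'M[R]_(n, m) := xchoose (pinv_exists X).

Lemma pinvP (R : realFieldType) (m n : nat) (X : 'M[R]_(m, n)) :
  is_pinv X (pinv X).
Proof. exact: xchooseP. Qed.

Definition pseudo_schur (R : realFieldType) (m n s p : nat)
    (A : 'M[R]_(m, n)) (B : 'M[R]_(m, p))
    (C : 'M[R]_(s, n)) (D : 'M[R]_(s, p)) : 'M[R]_(s, p) :=
  D - C *m pinv A *m B.

Definition comp_pseudo_schur (R : realFieldType) (m n s p : nat)
    (A : 'M[R]_(m, n)) (B : 'M[R]_(m, p))
    (C : 'M[R]_(s, n)) (D : 'M[R]_(s, p)) : 'M[R]_(m, n) :=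
  A - B *m pinv D *m C.

(* Main.v *)
(** Since F = 0 means D = C A^+ B, the column space of D lies in that of C and
    its row space in that of B; hence D^+ absorbs the orthogonal projectors:
    B^+ B D^+ C C^+ = D^+.  Multiplying A = B D^+ C by B^+ and C^+ therefore
    recovers D^+, and conversely B (B^+ A C^+) C = A when A is fixed by the
    projectors B B^+ and C^+ C. *)

Require Import Defs.
From mathcomp Require Import all_boot all_order all_algebra.
From mathcomp Require Import reals.
Set Implicit Arguments.
Unset Strict Implicit.
Unset Printing Implicit Defensive.
Import Order.TTheory GRing.Theory Num.Theory.
Local Open Scope ring_scope.

(** [P] fixes the symmetric matrix [X *m pinv X] from the left, hence by transposition from the
    right, and [pinv X] ends in that factor. *)
Lemma mulmx_pinv_absorb (R : realFieldType) (m n : nat)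
    (X : 'M[R]_(m, n)) (P : 'M[R]_m) :
  P^T = P -> P *m X = X -> pinv X *m P = pinv X.
Proof.
move=> PT PX; have /is_pinvP[_ X2 X3 _] := pinvP X.
have XP : X *m pinv X *m P = X *m pinv X.
  by rewrite -X3 -{1}PT -trmx_mul mulmxA PX.
by rewrite -X2 -!mulmxA (mulmxA X) XP.
Qed.

Lemma pinv_mulmx_absorb (R : realFieldType) (m n : nat)
    (X : 'M[R]_(m, n)) (Q : 'M[R]_n) :
  Q^T = Q -> X *m Q = X -> Q *m pinv X = pinv X.
Proof.
move=> QT XQ; have /is_pinvP[_ X2 _ X4] := pinvP X.
have QX : Q *m (pinv X *m X) = pinv X *m X.
  by rewrite -X4 -{1}QT -trmx_mul -mulmxA XQ.
by rewrite -X2 mulmxA QX.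
Qed.

Theorem theorem3p3 (R : realType) (m n s p : nat)
    (A : 'M[R]_(m, n)) (B : 'M[R]_(m, p))
    (C : 'M[R]_(s, n)) (D : 'M[R]_(s, p))
    (hF : pseudo_schur A B C D = 0) :
  comp_pseudo_schur A B C D = 0 <->
  [/\ (1%:M - B *m pinv B) *m A = 0,
      A *m (1%:M - pinv C *m C) = 0 &
      pinv (C *m pinv A *m B) = pinv B *m A *m pinv C].
Proof.
(* By [hF] the third condition becomes a formula for [pinv D], the inverse occurring in G. *)
move/subr0_eq: hF => DE; rewrite /comp_pseudo_schur -DE.
have /is_pinvP[B1 _ _ B4] := pinvP B.
have /is_pinvP[C1 _ C3 _] := pinvP C.
split=> [/subr0_eq AE | [/eqP]].
  split.
  - by rewrite mulmxBl mul1mx AE !mulmxA B1 subrr.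
  - by rewrite mulmxBr mulmx1 AE -!mulmxA (mulmxA C) C1 subrr.
  (* [D] begins with [C], so the symmetric [C *m pinv C] fixes it; dually for [B] below. *)
  have DC : pinv D *m (C *m pinv C) = pinv D.
    by apply: mulmx_pinv_absorb => //; rewrite DE !mulmxA C1.
  have BD : pinv B *m B *m pinv D = pinv D.
    by apply: pinv_mulmx_absorb => //; rewrite DE -!mulmxA (mulmxA B) B1.
  by rewrite AE !mulmxA BD -mulmxA DC.
rewrite mulmxBl mul1mx subr_eq0 => /eqP BA /eqP.
rewrite mulmxBr mulmx1 subr_eq0 => /eqP AC ->.
(* [BA] and [AC] collapse the two projectors around [A] in turn. *)
by rewrite !mulmxA -BA -mulmxA -AC subrr.
Qed.
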